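(* Let $(E,q)$ be a formed space. Suppose that $f:U\to W$ is a bijective isometry between two subspaces of $E$ such that $f\big(U\cap\mathcal{K}(E)\big)=W\cap\mathcal{K}(E)$. Then $f$ can be extended to a bijective isometry of $E$. In particular, the group $\mathbf{G}(E,q)$ of bijective isometries of $(E,q)$ acts transitively on the set of isotropic subspaces $U$ of $E$ with given values of $\dim U$ and $\dim (U\cap\mathcal{R}(E))$.
   Context: Let $\mathbb{F}$ be a (commutative) field and $\sigma:\mathbb{F}\to\mathbb{F}$ an involution, i.e. a field automorphism with $\sigma^2=\mathrm{id}$ (possibly $\sigma=\mathrm{id}$); write $\bar x=\sigma(x)$. Fix $\varepsilon\in\mathbb{F}$ with $\varepsilon\bar\varepsilon=1$ and an additive subgroup $\Lambda\le\mathbb{F}$ with $\Lambda_{min}\le\Lambda\le\Lambda_{max}$, where $\Lambda_{min}=\{a-\varepsilon\bar a : a\in\mathbb{F}\}$ and $\Lambda_{max}=\{a\in\mathbb{F} : a+\varepsilon\bar a=0\}$. For an $\mathbb{F}$-vector space $E$, $\mathrm{Sesq}_\sigma(E)$ is the space of sesquilinear maps $f:E\times E\to\mathbb{F}$ (biadditive with $f(av,bw)=\bar a f(v,w)b$), and $X(E,\sigma,\varepsilon,\Lambda)$ is its additive subgroup of all $f$ with $f(v,v)\in\Lambda$ and $f(w,v)=-\varepsilon\overline{f(v,w)}$ for all $v,w\in E$. A form on $E$ is an element $q$ of $\mathrm{Form}(E,\sigma,\varepsilon,\Lambda)=\mathrm{Sesq}_\sigma(E)/X(E,\sigma,\varepsilon,\Lambda)$.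 A formed space $(E,q)$ is a finite-dimensional $\mathbb{F}$-vector space $E$ with a form $q$ (the form may be degenerate). For a form $q$, set $\omega_q(v,w)=q(v,w)+\varepsilon\overline{q(w,v)}\in\mathbb{F}$ and $Q_q(v)=q(v,v)+\Lambda\in\mathbb{F}/\Lambda$ (these depend only on the class of $q$). Forms pull back along linear maps by $f^*q(v,w)=q(f(v),f(w))$; subspaces of $E$ carry the restricted form. A linear map $f:(E,q)\to(E',q')$ of formed spaces is an isometry if $f^*q'=q$ as forms, equivalently if it preserves $\omega$ and $Q$ (it is not required to be bijective). The kernel is $\mathcal{K}(E)=\{v\in E : \omega_q(w,v)=0 \text{ for all } w\in E\}$. The radical is $\mathcal{R}(E)=\{v\in\mathcal{K}(E) : Q_q(v)=0\}$. A subspace $U\le E$ is isotropic if $q|_U=0$ as a form, equivalently $\omega_q|_U=0$ and $Q_q|_U=0$. *)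

(* Defs.v *)
From HB Require Import structures.
From mathcomp Require Import all_boot all_order all_algebra.
From mathcomp Require Import sesquilinear ring_quotient.
From mathcomp Require Import boolp classical_sets.

Set Implicit Arguments.
Unset Strict Implicit.
Unset Printing Implicit Defensive.

Import GRing.Theory.

Local Open Scope ring_scope.
Local Open Scope quotient_scope.
Local Open Scope classical_set_scope.

Section FormParameter.
Variables (F : fieldType) (sigma : {rmorphism F -> F}) (eps : F).

Definition Lambda_min : set F := [set a - eps * sigma a | a in [set: F]].

Definition Lambda_max : set F := [set a | a + eps * sigma a = 0].

End FormParameter.

(* Sesq_sigma(E): f (a *: v) (b *: w) = sigma a * (b * f v w). *)
Definition sesq (F : fieldType) (sigma : {rmorphism F -> F}) (E : vectType F) :=
  {bilinear E -> E -> F | sigma \; *%R & *%R}.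

Section SesqZmodule.
Variables (F : fieldType) (sigma : {rmorphism F -> F}) (E : vectType F).
Implicit Types s t u : sesq sigma E.

Lemma sesqP s t : (forall v w, s v w = t v w) -> s = t.
Proof.
case: s t => [s [[s1 s2 s3 s4]]] [t [[t1 t2 t3 t4]]] /= st.
have {}st : s = t by apply/funext => v; apply/funext => w; apply: st.
rewrite st in s1 s2 s3 s4 *.
by congr (Bilinear.Pack (Bilinear.Class _)); congr isBilinear.Axioms_;
  apply: Prop_irrelevance.
Qed.

Section Add.
Variables s t : sesq sigma E.
Definition sesq_add_fun (v w : E) : F := s v w + t v w.
Fact sesq_add_bilinear :
  bilinear_for (sigma \; *%R : GRing.Scale.law F F) ( *%R : GRing.Scale.law F F)
    sesq_add_fun.
Proof.
split=> [w|v] a x y; rewrite /sesq_add_fun /=.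
  by rewrite !linearPl /= mulrDr addrACA.
by rewrite !linearPr /= mulrDr addrACA.
Qed.
HB.instance Definition _ :=
  bilinear_isBilinear.Build F E E F _ _ sesq_add_fun sesq_add_bilinear.
Definition sesq_add : sesq sigma E := sesq_add_fun.
End Add.

Section Opp.
Variable s : sesq sigma E.
Definition sesq_opp_fun (v w : E) : F := - s v w.
Fact sesq_opp_bilinear :
  bilinear_for (sigma \; *%R : GRing.Scale.law F F) ( *%R : GRing.Scale.law F F)
    sesq_opp_fun.
Proof.
split=> [w|v] a x y; rewrite /sesq_opp_fun /=.
  by rewrite !linearPl /= opprD mulrN.
by rewrite !linearPr /= opprD mulrN.
Qed.
HB.instance Definition _ :=
  bilinear_isBilinear.Build F E E F _ _ sesq_opp_fun sesq_opp_bilinear.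
Definition sesq_opp : sesq sigma E := sesq_opp_fun.
End Opp.

Definition sesq_zero_fun (v w : E) : F := 0.
Fact sesq_zero_bilinear :
  bilinear_for (sigma \; *%R : GRing.Scale.law F F) ( *%R : GRing.Scale.law F F)
    sesq_zero_fun.
Proof. by split=> [w|v] a x y; rewrite /sesq_zero_fun /= mulr0 addr0. Qed.
HB.instance Definition _ :=
  bilinear_isBilinear.Build F E E F _ _ sesq_zero_fun sesq_zero_bilinear.
Definition sesq_zero : sesq sigma E := sesq_zero_fun.

HB.instance Definition _ := gen_eqMixin (sesq sigma E).
HB.instance Definition _ := gen_choiceMixin (sesq sigma E).

Fact sesq_addA : associative sesq_add.
Proof. by move=> s t u; apply: sesqP => v w; apply: addrA. Qed.
Fact sesq_addC : commutative sesq_add.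
Proof. by move=> s t; apply: sesqP => v w; apply: addrC. Qed.
Fact sesq_add0 : left_id sesq_zero sesq_add.
Proof. by move=> s; apply: sesqP => v w; apply: add0r. Qed.
Fact sesq_addN : left_inverse sesq_zero sesq_opp sesq_add.
Proof. by move=> s; apply: sesqP => v w; apply: addNr. Qed.

HB.instance Definition _ := GRing.isZmodule.Build (sesq sigma E)
  sesq_addA sesq_addC sesq_add0 sesq_addN.

Lemma sesqDE s t v w : (s + t) v w = s v w + t v w. Proof. by []. Qed.
Lemma sesqNE s v w : (- s) v w = - s v w. Proof. by []. Qed.
Lemma sesqBE s t v w : (s - t) v w = s v w - t v w. Proof. by []. Qed.
Lemma sesq0E v w : (0 : sesq sigma E) v w = 0. Proof. by []. Qed.

End SesqZmodule.

Section Forms.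
Variables (F : fieldType) (sigma : {rmorphism F -> F}) (eps : F).
Variable Lam : zmodClosed F.

Definition X_pred (E : vectType F) : {pred sesq sigma E} := fun s =>
  `[< (forall v, s v v \in Lam) /\
      (forall v w, s w v = - (eps * sigma (s v w))) >].

Fact X_zmod_closed (E : vectType F) : zmod_closed (@X_pred E).
Proof.
split=> [|s t /asboolP[s1 s2] /asboolP[t1 t2]]; apply/asboolP; split=> [v|v w].
- by rewrite sesq0E rpred0.
- by rewrite !sesq0E rmorph0 mulr0 oppr0.
- by rewrite sesqBE rpredB.
- by rewrite !sesqBE s2 t2 rmorphB mulrBr opprB opprK addrC.
Qed.
HB.instance Definition _ (E : vectType F) :=
  GRing.isZmodClosed.Build (sesq sigma E) (@X_pred E) (@X_zmod_closed E).

Definition Form (E : vectType F) := Quotient.quot (@X_pred E).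

Lemma form_eqP (E : vectType F) (s t : sesq sigma E) :
  \pi_(Form E) s = \pi_(Form E) t <->
  (forall v, s v v - t v v \in Lam) /\
  (forall v w, s w v - t w v = - (eps * sigma (s v w - t v w))).
Proof.
split=> [/eqP|st]; last apply/eqP; rewrite -Quotient.idealrBE.
  by move/asboolP.
exact/asboolP.
Qed.

Section Invariants.
Variable E : vectType F.
Implicit Types (q : Form E) (v w : E) (s : sesq sigma E).

(* omega, Qform and pullback are computed on the chosen representative of a class;
   omega_pi, Qform_pi and pull_pi give their values on any representative. *)
Definition omega q v w : F :=
  (repr q : sesq sigma E) v w + eps * sigma ((repr q : sesq sigma E) w v).

Definition Qform q v : Quotient.quot Lam :=
  \pi_(Quotient.quot Lam) ((repr q : sesq sigma E) v v).

Lemma repr_form s :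
  let t := repr (\pi_(Form E) s) : sesq sigma E in
  (forall v, t v v - s v v \in Lam) /\
  (forall v w, t w v - s w v = - (eps * sigma (t v w - s v w))).
Proof. by apply/form_eqP; rewrite reprK. Qed.

Lemma omega_pi s v w :
  omega (\pi_(Form E) s) v w = s v w + eps * sigma (s w v).
Proof.
rewrite /omega; have [_ /(_ w v)] := repr_form s.
rewrite rmorphB mulrBr opprB => /(canRL (subrK _)) ->.
by rewrite addrAC subrK addrC.
Qed.

Lemma Qform_pi s v : Qform (\pi_(Form E) s) v = \pi_(Quotient.quot Lam) (s v v).
Proof.
by apply/eqP; rewrite -Quotient.idealrBE; have [/(_ v)] := repr_form s.
Qed.

Definition kernel q : set E := [set v | forall w, omega q w v = 0].

Definition radical q : set E := [set v | kernel q v /\ Qform q v = 0].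

End Invariants.

Section Pullback.
Variables (E E' : vectType F) (f : {linear E -> E'}).

Section Sesq.
Variable s : sesq sigma E'.
Definition sesq_pull_fun (v w : E) : F := s (f v) (f w).
Fact sesq_pull_bilinear :
  bilinear_for (sigma \; *%R : GRing.Scale.law F F) ( *%R : GRing.Scale.law F F)
    sesq_pull_fun.
Proof.
split=> [w|v] a x y; rewrite /sesq_pull_fun linearP.
  by rewrite linearPl.
by rewrite linearPr.
Qed.
HB.instance Definition _ :=
  bilinear_isBilinear.Build F E E F _ _ sesq_pull_fun sesq_pull_bilinear.
Definition sesq_pull : sesq sigma E := sesq_pull_fun.
End Sesq.

Definition pull (q : Form E') : Form E := \pi_(Form E) (sesq_pull (repr q)).

Lemma pull_pi (s : sesq sigma E') :
  pull (\pi_(Form E') s) = \pi_(Form E) (sesq_pull s).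
Proof.
have [s1 s2] := repr_form s.
by apply/form_eqP; split=> [v|v w]; [apply: s1 | apply: s2].
Qed.

End Pullback.

Definition is_isometry (E E' : vectType F) (q : Form E) (q' : Form E')
  (f : {linear E -> E'}) : Prop := pull f q' = q.

Definition restrict_form (E : vectType F) (q : Form E) (U : {vspace E}) :
  Form (subvs_of U) := pull vsval q.

Definition isotropic (E : vectType F) (q : Form E) (U : {vspace E}) : Prop :=
  restrict_form q U = 0.

Definition isometry_group (E : vectType F) (q : Form E) : set 'End(E) :=
  [set g : 'End(E) | bijective (g : E -> E) /\ is_isometry q q g].

Section Group.
Variables (E : vectType F) (q : Form E).

Lemma pull_id (g : {linear E -> E}) : g =1 id -> pull g q = q.
Proof.
move=> gid; elim/quotW: q => s; rewrite pull_pi; congr (\pi_(Form E) _).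
by apply: sesqP => v w; rewrite /= /sesq_pull_fun !gid.
Qed.

Lemma pull_comp (g h k : {linear E -> E}) :
  (forall v, k v = g (h v)) -> pull k q = pull h (pull g q).
Proof.
move=> kgh; elim/quotW: q => s; rewrite (pull_pi g) !pull_pi.
congr (\pi_(Form E) _); apply: sesqP => v w.
by rewrite /= /sesq_pull_fun /= /sesq_pull_fun !kgh.
Qed.

Lemma isometry_group_id : isometry_group q \1%VF.
Proof.
split; first by exists id => v; exact: id_lfunE.
by apply: pull_id => v; exact: id_lfunE.
Qed.

Lemma isometry_group_comp (g h : 'End(E)) :
  isometry_group q g -> isometry_group q h -> isometry_group q (g \o h)%VF.
Proof.
move=> [bg ig] [bh ih]; split.
  by apply: (eq_bij (bij_comp bg bh)) => v; exact/esym/comp_lfunE.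
rewrite /is_isometry (@pull_comp g h) ?ig // => v.
exact: comp_lfunE.
Qed.

Lemma isometry_group_inv (g : 'End(E)) :
  isometry_group q g -> isometry_group q (g^-1)%VF.
Proof.
move=> [bg ig]; have gK : lker g == 0%VS by apply/lker0P/bij_inj.
have gV v : g ((g^-1)%VF v) = v.
  by case: bg => h hg gh; rewrite -(gh v) lker0_lfunK.
split; first by exists g => v; rewrite ?gV ?lker0_lfunK.
rewrite /is_isometry -{1}ig -(@pull_comp g _ (g \o g^-1)%VF) => [|v]; last first.
  exact: comp_lfunE.
by apply: pull_id => v; apply: etrans (comp_lfunE _ _ _) (gV v).
Qed.

End Group.

(* S is the underlying set of a subspace of dimension d. *)
Definition has_dim (E : vectType F) (S : set E) (d : nat) : Prop :=
  exists2 V : {vspace E}, S = [set` V] & \dim V = d.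

(* [radical q] is a mere set here: it need not be a linear subspace, as Lam is
   not assumed stable under x |-> sigma a * x * a.  Its intersection with an
   isotropic U is U :&: kernel q, hence always a subspace. *)
Definition isotropics (E : vectType F) (q : Form E) (d r : nat) :
  set {vspace E} :=
  [set U | [/\ isotropic q U, \dim U = d
             & has_dim ([set` U] `&` radical q) r]].

Definition acts_transitively (E : vectType F) (H : set 'End(E))
    (S : set {vspace E}) : Prop :=
  (forall g U, H g -> S U -> S (g @: U)%VS) /\
  (forall U W, S U -> S W -> exists2 g, H g & (g @: U)%VS = W).

End Forms.

(* Main.v *)
Require Import Defs.
From HB Require Import structures.
From mathcomp Require Import all_boot all_order all_algebra.
From mathcomp Require Import sesquilinear ring_quotient ring.
From mathcomp Require Import boolp classical_sets.

Set Implicit Arguments.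
Unset Strict Implicit.
Unset Printing Implicit Defensive.

Import GRing.Theory.

Local Open Scope ring_scope.
Local Open Scope quotient_scope.
Local Open Scope classical_set_scope.

(** Why the theorem holds.  Everything reduces to extending a linear map [f],
    injective and isometric on a subspace [U], such that [f u] lies in the
    kernel exactly when [u] does ([witt_extension]).  By induction on the
    dimension, write [U] as the sum of a hyperplane [H] and a line [<[u]>],
    extend [f] from [H] and compose [f] with the inverse of that extension.
    Then [f] is the identity on [H] and moves only [u], to some [u'].  It
    remains to find an isometry of the whole space that fixes [H] pointwise and
    sends [u] to [u'] ([witt_step]).  Put [x := u' - u]; it is orthogonal to
    [H], and one of three explicit isometries does the job.

    - If [u] and [x] are not orthogonal, the transvection (or quasi-reflection)
      in the direction [x] maps [u] to [u'].
    - Otherwise [Q] vanishes at [x].  If [x] is in the kernel, every shear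
      [v |-> v + phi v *: x] preserves the form, and [phi] only has to vanish on
      [H], take the value 1 at [u] and avoid the value -1 at [x].
    - If [x] is not in the kernel, the hypothesis on kernels keeps [u] and [u']
      out of [H + kernel], so the same [phi] can be chosen zero on the kernel
      too; it is then [omega z] for some [z], and a Siegel (or Eichler)
      transformation built from [x] and [z] acts as the shear on the vectors
      orthogonal to [x].

    The existence of [phi] is [functional_avoid]: the condition on -1 can be met
    precisely because [u' = x + u] is outside the subspace on which [phi] is
    zero.

    As [Lam] need not be stable under [a |-> sigma c * a * c], a value of [Q] at
    [v] does not determine its values on the line through [v].  A linear
    isometry preserves all of them, so [s v v], for a representative [s] of the
    form, is tracked modulo the largest stable subgroup [core] of [Lam].

    Transitivity follows: on an isotropic subspace the radical and the kernel
    cut out the same vectors, and any linear bijection between two isotropic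
    subspaces is isometric, so it is enough to match the two pairs
    (subspace, intersection with the radical) by a linear map. *)

(** * Forms are determined by [omega] and [Q] *)

Section FormInvariants.
Variables (F : fieldType) (sigma : {rmorphism F -> F}) (eps : F).
Variable Lam : zmodClosed F.
Local Notation Form := (Form sigma eps Lam).

Lemma Qform_eqP (E E' : vectType F) (q : Form E) (q' : Form E') v w :
  Qform q v = Qform q' w <->
  (repr q : sesq sigma E) v v - (repr q' : sesq sigma E') w w \in Lam.
Proof.
split=> [/eqP|h]; last apply/eqP; by rewrite -Quotient.idealrBE.
Qed.

Lemma form_extP (E : vectType F) (q q' : Form E) :
  q = q' <-> (forall v w, omega q v w = omega q' v w) /\
             (forall v, Qform q v = Qform q' v).
Proof.
split=> [-> //|[omE QE]]; rewrite -[q]reprK -[q']reprK; apply/form_eqP.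
split=> [v|v w]; first exact/Qform_eqP.
have := omE w v; rewrite /omega => /eqP; rewrite -subr_eq0 => /eqP h.
apply/eqP; rewrite -subr_eq0 opprK -[X in _ == X]h; apply/eqP.
rewrite rmorphB; ring.
Qed.

Lemma omega_pull (E E' : vectType F) (f : {linear E -> E'}) (q : Form E') v w :
  omega (pull f q) v w = omega q (f v) (f w).
Proof. by rewrite /pull omega_pi. Qed.

Lemma Qform_pull (E E' : vectType F) (f : {linear E -> E'}) (q : Form E') v :
  Qform (pull f q) v = Qform q (f v).
Proof. by rewrite /pull Qform_pi. Qed.

(** The equality of classes that defines isometries is thus the preservation of
    [omega] and of [Q], the form in which it is used below. *)
Lemma isometryP (E E' : vectType F) (q : Form E) (q' : Form E')
    (f : {linear E -> E'}) :
  is_isometry q q' f <-> (forall v w, omega q' (f v) (f w) = omega q v w) /\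
                         (forall v, Qform q' (f v) = Qform q v).
Proof.
rewrite /is_isometry form_extP.
by split=> -[omE QE]; split=> [v w|v];
  rewrite -?omE -?QE ?omega_pull ?Qform_pull.
Qed.

Lemma omega0 (E : vectType F) v w : omega (0 : Form E) v w = 0.
Proof.
have -> : (0 : Form E) = \pi_(Form E) 0 by rewrite raddf0.
by rewrite omega_pi !sesq0E rmorph0 mulr0 addr0.
Qed.

Lemma Qform0 (E : vectType F) v : Qform (0 : Form E) v = 0.
Proof.
have -> : (0 : Form E) = \pi_(Form E) 0 by rewrite raddf0.
by rewrite Qform_pi sesq0E raddf0.
Qed.

Lemma isotropicP (E : vectType F) (q : Form E) (U : {vspace E}) :
  isotropic q U <-> (forall v w, v \in U -> w \in U -> omega q v w = 0) /\
                    (forall v, v \in U -> Qform q v = 0).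
Proof.
rewrite /isotropic form_extP; split=> -[omE QE]; split=> [v w|v].
- move=> vU wU; have := omE (vsproj U v) (vsproj U w).
  by rewrite omega0 /restrict_form omega_pull /= !vsprojK.
- move=> vU; have := QE (vsproj U v).
  by rewrite Qform0 /restrict_form Qform_pull /= !vsprojK.
- by rewrite omega0 /restrict_form omega_pull omE ?subvsP.
- by rewrite Qform0 /restrict_form Qform_pull QE ?subvsP.
Qed.

End FormInvariants.

(** * Linear functionals with prescribed values *)

Section LinearFunctionals.
Variables (F : fieldType) (E : vectType F).

Lemma functional_sep (V : {vspace E}) v : v \notin V ->
  exists phi : 'Hom(E, F^o), (forall w, w \in V -> phi w = 0) /\ phi v = 1.
Proof.
move=> vV; pose w := v - projv V v.
have w0 : w != 0.
  by apply: contra vV; rewrite subr_eq0 => /eqP ->; apply: memv_proj.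
have [i wi] : exists i, coord (vbasis fullv) i w != 0.
  apply/existsP; apply: contraR w0 => /existsPn wi.
  rewrite (coord_vbasis (memvf w)) big1 // => i _.
  by have /negPn/eqP -> := wi i; rewrite scale0r.
pose c := coord (vbasis fullv) i w.
exists (c^-1 *: (linfun (coord (vbasis fullv) i : {linear E -> F^o})
                 \o (\1 - projv V))%VF).
split=> [y yV|];
  rewrite scale_lfunE comp_lfunE lfunE /= add_lfunE opp_lfunE id_lfunE.
  by rewrite projv_id // subrr linear0 scaler0.
exact: mulVf.
Qed.

(** If [u] is outside [V + <[x]>], then [phi x] can be taken to be 0.  If
    [u = w + c *: x] with [w] in [V], then [phi x] is forced to be [c^-1], which
    is -1 only when [x + u = w]. *)
Lemma functional_avoid (V : {vspace E}) u x : u \notin V -> x + u \notin V ->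
  exists phi : 'Hom(E, F^o),
    [/\ forall w, w \in V -> phi w = 0, phi u = 1 & phi x != -1].
Proof.
move=> uV xuV; have [|uVx] := boolP (u \in V + <[x]>)%VS; last first.
  have [phi [phi0 phi1]] := functional_sep uVx.
  exists phi; split=> // [w wV|]; first by rewrite phi0 // (subvP (addvSl _ _)).
  rewrite phi0 ?(subvP (addvSr _ _)) ?memv_line //.
  by rewrite eq_sym oppr_eq0 oner_eq0.
case/memv_addP=> w wV [_ /vlineP[c ->] uE].
have [phi [phi0 phi1]] := functional_sep uV.
exists phi; split=> //; apply: contra xuV => /eqP phix.
have : c = -1.
  apply/eqP; rewrite -eqr_oppLR -phi1 uE linearD linearZ /= phi0 // add0r phix.
  by rewrite [_ *: _]mulrN1.
by move=> cE; rewrite uE cE scaleN1r addrC subrK.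
Qed.
End LinearFunctionals.

(** * Values of the form modulo the stable core of [Lam] *)

Lemma mem_eq (T : Type) (P : {pred T}) a b : a \in P -> a = b -> b \in P.
Proof. by move=> aP <-. Qed.

Section Witt.
Variables (F : fieldType) (sigma : {rmorphism F -> F}) (eps : F).
Variable Lam : zmodClosed F.
Hypothesis sigmaK : involutive sigma.
Hypothesis eps_unitary : eps * sigma eps = 1.
Hypothesis Lam_min : Lambda_min sigma eps `<=` [set` Lam].
Hypothesis Lam_max : [set` Lam] `<=` Lambda_max sigma eps.

(** The largest subgroup of [Lam] stable under [a |-> sigma c * a * c].  It
    defines the same forms and isometries as [Lam], and with it preserving
    [Q] at [v] implies preserving it on the whole line through [v]. *)
Definition core : {pred F} := fun a => `[< forall c, sigma c * a * c \in Lam >].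

Lemma coreP a : reflect (forall c, sigma c * a * c \in Lam) (a \in core).
Proof. exact: asboolP. Qed.

Fact core_zmod_closed : zmod_closed core.
Proof.
split=> [|a b /coreP a_core /coreP b_core]; apply/coreP => c.
  by rewrite mulr0 mul0r rpred0.
by rewrite mulrBr mulrBl rpredB.
Qed.
HB.instance Definition _ := GRing.isZmodClosed.Build F core core_zmod_closed.

Lemma core_Lam a : a \in core -> a \in Lam.
Proof. by move/coreP => /(_ 1); rewrite rmorph1 mul1r mulr1. Qed.

Lemma core_conj c a : a \in core -> sigma c * a * c \in core.
Proof.
move/coreP => a_core; apply/coreP => d.
by apply: (mem_eq (a_core (c * d))); rewrite rmorphM; ring.
Qed.

(** [Lambda_min] is itself stable, so it is contained in [core]. *)
Lemma core_min a : a - eps * sigma a \in core.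
Proof.
apply/coreP => c.
suff: Lambda_min sigma eps (sigma c * (a - eps * sigma a) * c) by move/Lam_min.
by exists (sigma c * a * c) => //; rewrite !rmorphM sigmaK; ring.
Qed.

Lemma core_max a : a \in core -> a + eps * sigma a = 0.
Proof. by move/core_Lam/Lam_max. Qed.

Variables (E : vectType F) (q : Form sigma eps Lam E).
Implicit Types (u v w x y z : E) (U H : {vspace E}) (g f : 'End(E)).
Local Notation s := (repr q : sesq sigma E).
Local Notation om := (omega q).

Lemma reprDZl a v w y : s (v + a *: w) y = s v y + sigma a * s w y.
Proof. by rewrite linearDl linearZl_LR. Qed.

Lemma reprDZr a v w y : s y (v + a *: w) = s y v + a * s y w.
Proof. by rewrite linearDr linearZr_LR. Qed.

Lemma omegaDZl a v w y : om (v + a *: w) y = om v y + sigma a * om w y.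
Proof. by rewrite /omega reprDZl reprDZr rmorphD rmorphM; ring. Qed.

Lemma omegaDZr a v w y : om y (v + a *: w) = om y v + a * om y w.
Proof. by rewrite /omega reprDZl reprDZr rmorphD rmorphM sigmaK; ring. Qed.

Lemma omegaC v w : om w v = eps * sigma (om v w).
Proof. by rewrite /omega rmorphD rmorphM sigmaK; ring: eps_unitary. Qed.

Lemma omegavv v : om v v = s v v + eps * sigma (s v v). Proof. by []. Qed.

Lemma omega0r v : om v 0 = 0.
Proof. by rewrite /omega linear0r linear0l rmorph0 mulr0 addr0. Qed.

Lemma omega_is_linear v : linear (om v : E -> F^o).
Proof. by move=> a w y; rewrite [a *: w + y]addrC omegaDZr addrC. Qed.
HB.instance Definition _ v :=
  GRing.isLinear.Build F E F^o _ (om v) (omega_is_linear v).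

Lemma omega_sumZl (I : finType) (a : I -> F) (e : I -> E) v :
  om (\sum_i a i *: e i) v = \sum_i sigma (a i) * om (e i) v.
Proof.
elim/big_rec2: _ => [|i y z _ IH].
  by rewrite omegaC omega0r rmorph0 mulr0.
by rewrite [_ + z]addrC omegaDZl IH addrC.
Qed.

Lemma omega_eq0C v w : (om v w == 0) = (om w v == 0).
Proof.
have eps0 : eps != 0.
  by apply: contra_eq_neq eps_unitary => ->; rewrite mul0r eq_sym oner_eq0.
by rewrite omegaC mulf_eq0 (negPf eps0) fmorph_eq0.
Qed.

(** [Q (v + a *: w) = Q v + Q (a *: w) + omega v (a *: w)]: exchanging the two
    cross terms of [s] costs an element of [Lambda_min]. *)
Lemma repr_quad a v w :
  s (v + a *: w) (v + a *: w)
    - (s v v + sigma a * s w w * a + a * om v w) \in core.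
Proof.
apply: (mem_eq (core_min (sigma a * s w v))).
by rewrite reprDZl !reprDZr rmorphM sigmaK /omega; ring.
Qed.

Definition isom_on U g : Prop :=
  {in U &, forall v w, om (g v) (g w) = om v w} /\
  {in U, forall v, s (g v) (g v) - s v v \in core}.

(** * The kernel and the functionals represented by [omega] *)

Let n := \dim {:E}.
Let e (i : 'I_n) : E := (vbasis {:E})`_i.

(** Left multiplication by [omega] is only semilinear, so the kernel and the
    represented functionals are described through the linear coordinates
    [omega (e i)] attached to a basis. *)
Definition omega_row_fun v : 'rV[F]_n := \row_i om (e i) v.
Fact omega_row_linear : linear omega_row_fun.
Proof. by move=> a v w; apply/rowP => i; rewrite !mxE linearP. Qed.
HB.instance Definition _ :=
  GRing.isLinear.Build F E 'rV[F]_n _ omega_row_fun omega_row_linear.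

Definition omega_row : 'Hom(E, 'rV[F]_n) := linfun omega_row_fun.

Definition kernel_vs : {vspace E} := lker omega_row.

Lemma omega_rowE v i : omega_row v 0 i = om (e i) v.
Proof. by rewrite lfunE /= mxE. Qed.

Lemma kernel_vsP v : reflect (kernel q v) (v \in kernel_vs).
Proof.
rewrite memv_ker; apply: (iffP eqP) => [v0 w|v0]; last first.
  by apply/rowP => i; rewrite omega_rowE mxE v0.
rewrite (coord_vbasis (memvf w)) omega_sumZl big1 // => i _.
by rewrite -[om _ _]omega_rowE v0 mxE mulr0.
Qed.

Lemma kernel_omegar v w : v \in kernel_vs -> om w v = 0.
Proof. by move/kernel_vsP. Qed.

Lemma kernel_omegal v w : v \in kernel_vs -> om v w = 0.
Proof. by move=> /kernel_omegar h; apply/eqP; rewrite omega_eq0C h. Qed.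

(** A functional that vanishes on the kernel factors through [omega_row], so
    it is a combination of the coordinates [omega (e i)]; conjugating the
    coefficients moves the combination inside [omega]. *)
Lemma omega_represents (phi : 'Hom(E, F^o)) :
  {in kernel_vs, forall v, phi v = 0} -> exists z, forall v, om z v = phi v.
Proof.
move=> phi0; pose psi := (phi \o omega_row^-1)%VF.
exists (\sum_i sigma (psi (delta_mx 0 i)) *: e i) => v.
have -> : phi v = psi (omega_row v).
  apply/eqP; rewrite comp_lfunE -subr_eq0 -linearB /= phi0 // memv_ker.
  by rewrite linearB /= limg_lfunVK ?subrr // memv_img ?memvf.
rewrite omega_sumZl [omega_row v]row_sum_delta linear_sum /=.
apply: eq_bigr => i _; rewrite sigmaK linearZ /= omega_rowE.
by rewrite mulrC.
Qed.

(** The elements of [isometry_group q], with [Q] compared modulo [core];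
    injectivity suffices in finite dimension. *)
Definition isometric g : Prop := isom_on fullv g /\ lker g == 0%VS.

(** A vector killed by an isometry is orthogonal to everything, hence it lies in
    the kernel, where the map is the identity. *)
Lemma isom_fix_kernel g :
  isom_on fullv g -> {in kernel_vs, g =1 id} -> isometric g.
Proof.
move=> [gom gQ] gK; split=> [//|]; rewrite -subv0; apply/subvP => v.
rewrite memv_ker memv0 => /eqP gv0; rewrite -[v]gK ?gv0 //.
by apply/kernel_vsP => w; rewrite -(gom w v) ?memvf // gv0 omega0r.
Qed.

(** * Three families of isometries *)

Definition rank1 (phi : {linear E -> F^o}) x v : E := phi v *: x.
Fact rank1_linear phi x : linear (rank1 phi x).
Proof. by move=> a v w; rewrite /rank1 linearP scalerDl scalerA. Qed.
HB.instance Definition _ phi x :=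
  GRing.isLinear.Build F E E _ (rank1 phi x) (rank1_linear phi x).

(** Adding [(c * omega x v) *: x] to [v] changes [Q v] by
    [sigma (omega x v) * t * omega x v], where [t] is the element assumed to be
    in [core]; the change of [omega v w] is likewise a multiple of
    [t + eps * sigma t], which is 0 on [core]. *)
Lemma transvection_isometry x c : sigma c * s x x * c + eps * c \in core ->
  exists2 g, isometric g & forall v, g v = v + (c * om x v) *: x.
Proof.
set t := _ + _ => t_core.
pose g : 'End(E) := (\1 + linfun (rank1 (om x : E -> F^o) (c *: x)))%VF.
have gE v : g v = v + (c * om x v) *: x.
  by rewrite add_lfunE id_lfunE lfunE /= /rank1 scalerA mulrC.
exists g => //; apply: isom_fix_kernel => [|v /kernel_omegar vK]; last first.
  by rewrite gE vK mulr0 scale0r addr0.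
split=> [v w _ _|v _]; rewrite !gE.
  rewrite omegaDZl !omegaDZr omegavv (omegaC x v).
  have := core_max t_core; rewrite /t.
  move: (om x v) (om x w) (om v w) (s x x) => a b d r.
  rewrite !(rmorphD, rmorphM) sigmaK => h.
  apply/eqP; rewrite -subr_eq0; apply/eqP.
  transitivity (sigma a * b * 0); last by rewrite mulr0.
  by rewrite -[in RHS]h; ring: eps_unitary.
have h := repr_quad (c * om x v) v x.
apply: (mem_eq (rpredD h (core_conj (om x v) t_core))).
rewrite (omegaC x v) /t.
move: (om x v) => a; rewrite rmorphM; ring.
Qed.

(** Moving along a vector of the radical never changes the form, and the
    condition on [phi x] makes the shear injective. *)
Lemma radical_shear_isometry x (phi : 'Hom(E, F^o)) :
  x \in kernel_vs -> s x x \in core -> phi x != -1 ->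
  exists2 g, isometric g & forall v, g v = v + phi v *: x.
Proof.
move=> xK xQ phix.
pose g : 'End(E) := (\1 + linfun (rank1 phi x))%VF.
have gE v : g v = v + phi v *: x by rewrite add_lfunE id_lfunE lfunE.
exists g => //; split; last first.
  rewrite -subv0; apply/subvP => v; rewrite memv_ker memv0 gE => /eqP gv0.
  have : phi v * (1 + phi x) = 0.
    by rewrite -(linear0 phi) -gv0 linearD linearZ /= mulrDr mulr1.
  move/eqP; rewrite mulf_eq0 addrC addr_eq0 (negPf phix) orbF => /eqP phiv.
  by rewrite -gv0 phiv scale0r addr0.
split=> [v w _ _|v _]; rewrite !gE.
  rewrite omegaDZl !omegaDZr !(kernel_omegar _ xK) !(kernel_omegal _ xK).
  by rewrite !(mulr0, addr0).
apply: (mem_eq (rpredD (repr_quad (phi v) v x) (core_conj (phi v) xQ))).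
rewrite (kernel_omegar _ xK); ring.
Qed.

(** On the vectors orthogonal to [x] this is the shear
    [v |-> v + omega z v *: x]; the terms in [omega x v] correct it elsewhere.
    For [omega x z = 0] it is the classical Siegel transformation; allowing
    [omega x z != 0] also covers the rescalings of [x] in a hyperbolic plane
    containing it. *)
Lemma siegel_isometry x z b : s x x \in core -> b * (eps + om x z) = -1 ->
  exists2 g, isometric g &
    forall v, g v = v + (om z v + b * s z z * om x v) *: x + (b * om x v) *: z.
Proof.
move=> xQ bE.
pose g : 'End(E) := (\1 + linfun (rank1 (om z : E -> F^o) x)
  + linfun (rank1 (om x : E -> F^o) (b *: (z + s z z *: x))))%VF.
have gE v : g v = v + (om z v + b * s z z * om x v) *: x + (b * om x v) *: z.
  rewrite !add_lfunE id_lfunE !lfunE.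
  rewrite -[LHS]/(v + om z v *: x + om x v *: (b *: (z + s z z *: x))).
  move: (om z v) (om x v) => a d.
  rewrite !scalerDr scalerDl !scalerA -!addrA; congr (_ + (_ + _)).
  by rewrite addrC; congr (_ *: _ + _ *: _); ring.
exists g => //; apply: isom_fix_kernel => [|v /kernel_omegar vK]; last first.
  by rewrite gE !vK !mulr0 addr0 !scale0r !addr0.
have bE' : sigma b * (sigma eps + sigma (om x z)) = -1.
  by rewrite -rmorphD -rmorphM bE rmorphN1.
split=> [v w _ _|v _]; rewrite !gE.
  rewrite !omegaDZl !omegaDZr (omegaC x v) (omegaC z v) (omegaC x z) !omegavv.
  rewrite (core_max xQ).
  move: (om x v) (om x w) (om z v) (om z w) (om v w) (om x z) (s z z) bE bE'.
  move=> p p' r r' d m t bE bE'; rewrite !(rmorphD, rmorphM).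
  apply/eqP; rewrite -subr_eq0; apply/eqP.
  (* The defect vanishes because of the equation satisfied by b and of its
     conjugate: it is a combination of the two. *)
  transitivity (
    sigma p * r' * (eps * (sigma b * (sigma eps + sigma m)) + eps)
    + sigma r * p' * (b * (eps + m) + 1)
    + sigma p * p' * (sigma b * sigma t * (b * (eps + m) + 1)
                      + b * t * eps * (sigma b * (sigma eps + sigma m) + 1))).
    ring: eps_unitary.
  by rewrite bE bE'; ring.
move=> {gE}; set a := om z v + _; set d := b * om x v.
have h1 := repr_quad d (v + a *: x) z; have h2 := repr_quad a v x.
have h3 := core_conj a xQ.
(* Up to a multiple of s x x, the change of Q v splits into a part in omega z v
   and omega x v and a part in omega x v alone, both in Lambda_min once the
   equation for b is used. *)
have h4 := core_min (sigma (om z v) * om x v).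
have h5 := core_conj (om x v) (core_min (sigma b * sigma (s z z))).
have h6 := core_conj d (core_min (s z z)).
apply: (mem_eq (rpredD (rpredD (rpredD h1 h2) (rpredB h3 h4)) (rpredB h6 h5))).
rewrite omegaDZl (omegaC x v) (omegaC z v).
move: (s (v + a *: x + _) _) (s (v + a *: x) _) => A0 A1; rewrite /d /a.
move: (s v v) (s x x) (om z v) (om x v) (om x z) (s z z) bE bE'.
move=> A2 A3 r p m t bE bE'; rewrite !(rmorphD, rmorphM) !sigmaK.
apply/eqP; rewrite -subr_eq0; apply/eqP.
transitivity (- ((sigma r * p + p * sigma p * sigma b * sigma t)
                 * (b * (eps + m) + 1))).
  ring: eps_unitary.
by rewrite bE; ring.
Qed.

(** * Extension of isometries *)

Lemma isometric_id : isometric \1%VF.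
Proof.
split; last by apply/lker0P => v w; rewrite !id_lfunE.
by split=> [v w _ _|v _]; rewrite !id_lfunE // subrr rpred0.
Qed.

Lemma isometric_comp g g' :
  isometric g -> isometric g' -> isometric (g \o g')%VF.
Proof.
move=> [[gom gQ] /lker0P gi] [[gom' gQ'] /lker0P gi']; split; last first.
  by apply/lker0P => v w; rewrite !comp_lfunE => /gi /gi'.
split=> [v w _ _|v _]; rewrite !comp_lfunE ?gom ?gom' ?memvf //.
by apply: (mem_eq (rpredD (gQ (g' v) (memvf _)) (gQ' v (memvf _)))); ring.
Qed.

Lemma isometric_inv g : isometric g -> isometric (g^-1)%VF.
Proof.
move=> [[gom gQ] gi]; have gV := lker0_lfunVK gi; split; last first.
  by apply/lker0P; apply: can_inj gV.
split=> [v w _ _|v _]; first by rewrite -gom ?memvf // !gV.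
by rewrite -opprB -{1 2}[v]gV rpredN gQ ?memvf.
Qed.

(** The hypothesis on [kernel_vs] says that the map equal to the identity on [H]
    and sending [u] to [u'] respects membership in the kernel.  It is what makes
    [phi] available when [x = u' - u] is outside the kernel: if [u] were in
    [H + kernel], so would be [u'], with the same component in [H], and [x]
    would be in the kernel. *)
Lemma witt_step H u u' :
    u \notin H -> u' \notin H ->
    {in H, forall h, om h u' = om h u} -> s u' u' - s u u \in core ->
    {in H, forall h, (u - h \in kernel_vs) = (u' - h \in kernel_vs)} ->
  exists2 g, isometric g & {in H, g =1 id} /\ g u = u'.
Proof.
move=> uH u'H omH Qu KH; pose x := u' - u.
have u'E : u' = u + x by rewrite addrC subrK.
have xH : {in H, forall h, om h x = 0}.
  by move=> h hH; rewrite linearB /= omH // subrr.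
have xH' : {in H, forall h, om x h = 0}.
  by move=> h hH; apply/eqP; rewrite omega_eq0C xH.
have xQ : s x x + om u x \in core.
  apply: (mem_eq (rpredB Qu (repr_quad 1 u x))).
  by rewrite scale1r -u'E rmorph1; ring.
(* The scalar (omega x u)^-1 is the one for which the transvection adds exactly
   x to u, and the equality of Q u and Q u' is the condition it must satisfy. *)
have [ux0|ux0] := eqVneq (om u x) 0; last first.
  have xu0 : om x u != 0 by rewrite omega_eq0C.
  have [|g g_iso gE] := @transvection_isometry x (om x u)^-1.
    apply: (mem_eq (core_conj (om x u)^-1 xQ)).
    rewrite (omegaC x u); move: (om x u) xu0 => w w0.
    rewrite mulrDr mulrDl; congr (_ + _).
    by rewrite mulrCA fmorphV mulVf ?fmorph_eq0 // mulr1.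
  exists g => //; split=> [h hH|]; rewrite gE.
    by rewrite (xH' h) // mulr0 scale0r addr0.
  by rewrite mulVf // scale1r -u'E.
rewrite ux0 addr0 in xQ.
have xu0 : om x u = 0 by apply/eqP; rewrite omega_eq0C ux0.
have [xK|xK] := boolP (x \in kernel_vs).
  have [|phi [phiH phiu phix]] := functional_avoid (x := x) uH.
    by rewrite subrK.
  have [g g_iso gE] := radical_shear_isometry xK xQ phix.
  exists g => //; split=> [h hH|]; rewrite gE.
    by rewrite phiH // scale0r addr0.
  by rewrite phiu scale1r -u'E.
have uHK : u \notin (H + kernel_vs)%VS.
  apply: contra xK => /memv_addP[h hH [k kK uE]].
  have uhK : u - h \in kernel_vs by rewrite uE addrAC subrr add0r.
  have u'hK : u' - h \in kernel_vs by rewrite -KH.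
  by have := rpredB u'hK uhK; rewrite opprB addrA subrK.
have u'HK : x + u \notin (H + kernel_vs)%VS.
  apply: contra xK; rewrite subrK => /memv_addP[h hH [k kK uE]].
  have uhK : u' - h \in kernel_vs by rewrite uE addrAC subrr add0r.
  have u'hK : u - h \in kernel_vs by rewrite KH.
  by have := rpredB uhK u'hK; rewrite opprB addrA subrK.
have [phi [phiH phiu phix]] := functional_avoid uHK u'HK.
have [v vK|z zE] := @omega_represents phi.
  by rewrite phiH // (subvP (addvSr _ _)).
(* Here omega z x <> -1 says exactly that b can be solved for. *)
have bne : eps + om x z != 0.
  rewrite addrC addr_eq0; apply: contra phix => /eqP xz.
  by rewrite -zE omegaC xz rmorphN mulrN eps_unitary.
have [|g g_iso gE] := @siegel_isometry x z (- (eps + om x z)^-1) xQ.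
  by rewrite mulNr mulVf.
exists g => //; split=> [h hH|]; rewrite gE.
  rewrite (xH' h) // zE phiH; last by rewrite (subvP (addvSl _ _)).
  by rewrite !mulr0 addr0 !scale0r !addr0.
by rewrite xu0 zE phiu !mulr0 addr0 scale0r addr0 scale1r -u'E.
Qed.

Theorem witt_extension U f :
    isom_on U f -> {in U &, injective f} ->
    {in U, forall u, (f u \in kernel_vs) = (u \in kernel_vs)} ->
  exists2 g, isometric g & {in U, g =1 f}.
Proof.
move: {2}(\dim U) (erefl (\dim U)) => d; elim: d => [|d IH] in U f *.
  move/eqP; rewrite dimv_eq0 => /eqP -> _ _ _; exists \1%VF.
    exact: isometric_id.
  by move=> u; rewrite memv0 => /eqP ->; rewrite !linear0.
move=> dimU [fom fQ] finj fK.
have u0 : vpick U != 0 by rewrite vpick0 -dimv_eq0 dimU.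
move: (vpick U) (memv_pick U) u0 => u uU u0.
pose H := (U :\: <[u]>)%VS.
have HU : (H <= U)%VS by apply: diffvSl.
have uH : u \notin H.
  apply: contra u0 => uH.
  by rewrite -memv0 -(capv_diff U <[u]>) memv_cap uH memv_line.
have UE : (H + <[u]> = U)%VS.
  by rewrite addv_diff; apply/addv_idPl; rewrite -memvE.
have dimH : \dim H = d.
  apply: succn_inj; rewrite -dimU -UE dimv_disjoint_sum ?capv_diff //.
  by rewrite dim_vline u0 addn1.
have [|h hH k kH|h hH|g0 g0_iso g0E] := IH H f dimH.
- by split=> [h k hH kH|h hH]; [apply: fom | apply: fQ]; apply: (subvP HU).
- by apply: finj; apply: (subvP HU).
- by apply: fK; apply: (subvP HU).
have [[gom gQ] gi] := isometric_inv g0_iso.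
have g0K := lker0_lfunK g0_iso.2.
have g0VK := lker0_lfunVK g0_iso.2.
have fh h : h \in H -> (g0^-1)%VF (f h) = h by move=> hH; rewrite -g0E ?g0K.
pose u' := (g0^-1)%VF (f u).
have kerg v : ((g0^-1)%VF v \in kernel_vs) = (v \in kernel_vs).
  apply/kernel_vsP/kernel_vsP => vK w; last by rewrite -[w]g0K gom ?memvf.
  by rewrite -gom ?memvf // vK.
have [|h hH||h hH|g g_iso [gH gu]] := @witt_step H u u' uH.
- apply: contra uH => u'H; suff <- : u' = u by [].
  by apply: finj => //; [apply: (subvP HU) | rewrite -g0E // /u' g0VK].
- by rewrite -{1}[h]fh // gom ?memvf // fom // (subvP HU).
- by apply: (mem_eq (rpredD (gQ (f u) (memvf _)) (fQ u uU))); rewrite /u'; ring.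
- by rewrite -{2}[h]fh // -linearB -linearB /= kerg fK // rpredB // (subvP HU).
exists (g0 \o g)%VF; first exact: isometric_comp.
move=> v; rewrite -{1}UE => /memv_addP[h hH [_ /vlineP[c ->] ->]].
by rewrite comp_lfunE !(linearD, linearZ) /= gH // gu /u' g0VK g0E.
Qed.

(** [Q] is preserved on each line of [U], so its change lies in [core]. *)
Lemma isom_onI U f :
    {in U &, forall v w, om (f v) (f w) = om v w} ->
    {in U, forall v, Qform q (f v) = Qform q v} -> isom_on U f.
Proof.
move=> fom fQ; split=> // v vU; apply/coreP => c.
have /Qform_eqP := fQ (c *: v) (memvZ c vU).
rewrite linearZ !linearZl_LR !linearZr_LR /= => h.
by apply: (mem_eq h); rewrite /GRing.scale /=; ring.
Qed.

Lemma isometric_group g : isometric g -> isometry_group q g.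
Proof.
move=> [[gom gQ] gi]; split.
  by exists (g^-1)%VF; [apply: lker0_lfunK | apply: lker0_lfunVK].
apply/isometryP; split=> [v w|v]; first by rewrite gom ?memvf.
by apply/Qform_eqP; apply: core_Lam; apply: gQ; apply: memvf.
Qed.

Theorem witt_extension_group U f :
    {in U &, forall v w, om (f v) (f w) = om v w} ->
    {in U, forall v, Qform q (f v) = Qform q v} -> {in U &, injective f} ->
    {in U, forall u, kernel q (f u) <-> kernel q u} ->
  exists2 g, isometry_group q g & {in U, g =1 f}.
Proof.
move=> fom fQ finj fK.
have [u uU|g g_iso gE] := witt_extension (isom_onI fom fQ) finj.
  by apply/kernel_vsP/kernel_vsP => /fK; apply.
by exists g => //; apply: isometric_group.
Qed.

(** * Isotropic subspaces *)

Lemma isometry_group_radical g v :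
  isometry_group q g -> radical q (g v) <-> radical q v.
Proof.
move=> [[h hK gK] /isometryP[gom gQ]]; rewrite /radical /= gQ.
split=> -[vK v0]; split=> // w; first by rewrite -gom.
by rewrite -[w]gK gom.
Qed.

Lemma isometry_group_isotropics g d r U :
  isometry_group q g -> isotropics q d r U -> isotropics q d r (g @: U)%VS.
Proof.
move=> gG [/isotropicP[Uom UQ] dimU [V VE dimV]].
have [gb /isometryP[gom gQ]] := gG.
have gi : lker g == 0%VS by apply/lker0P/bij_inj.
have dimg X : \dim (g @: X) = \dim X.
  by apply: limg_dim_eq; rewrite (eqP gi) capv0.
split; [apply/isotropicP; split | by rewrite dimg | exists (g @: V)%VS].
- by move=> _ _ /memv_imgP[v vU ->] /memv_imgP[w wU ->]; rewrite gom Uom.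
- by move=> _ /memv_imgP[v vU ->]; rewrite gQ UQ.
- have VP v : v \in V <-> v \in U /\ radical q v.
    by rewrite -[is_true (v \in V)]/([set` V] v) -VE.
  apply/seteqP; split=> [_ [/memv_imgP[v vU ->]]|_ /memv_imgP[v /VP[vU vR] ->]].
    by move/(isometry_group_radical _ gG) => vR; apply: memv_img; apply/VP.
  by split; [apply: memv_img | apply/isometry_group_radical].
- by rewrite dimg.
Qed.

Lemma isotropic_radical U v :
  isotropic q U -> v \in U -> radical q v <-> kernel q v.
Proof.
by move=> /isotropicP[_ UQ] vU; split=> [[] //|vK]; split=> //; apply: UQ.
Qed.

End Witt.

Section Flags.
Variables (F : fieldType) (E : vectType F).
Implicit Types (U V : {vspace E}).

Lemma flag_transport U V U' V' :
    (V <= U)%VS -> (V' <= U')%VS -> \dim U = \dim U' -> \dim V = \dim V' ->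
  exists f : 'End(E),
    [/\ {in U &, injective f}, (f @: U = U')%VS & (f @: V = V')%VS].
Proof.
move=> VU VU' dU dV.
have flag_basis (X Y : {vspace E}) :
    (Y <= X)%VS -> basis_of X (vbasis Y ++ vbasis (X :\: Y)%VS).
  move=> YX; have XE : (Y + (X :\: Y) = X)%VS.
    by rewrite addvC addv_diff; apply/addv_idPl.
  rewrite -{1}XE; apply: cat_basis; rewrite ?vbasisP //.
  by apply/directv_addP; rewrite capvC capv_diff.
have dC (X Y : {vspace E}) :
    (Y <= X)%VS -> \dim (X :\: Y) = (\dim X - \dim Y)%N.
  by move=> YX; rewrite -(dimv_cap_compl X Y) (capv_idPr YX) addKn.
have bU := flag_basis _ _ VU; have bU' := flag_basis _ _ VU'.
set b := _ ++ _ in bU; set b' := _ ++ _ in bU'.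
have [f0 f0E] := linear_of_free b b'.
have fb : map f0 b = b'.
  apply: f0E; first exact: basis_free bU.
  by rewrite /b /b' !size_cat !size_tuple !dC // dU dV.
pose f : 'End(E) := linfun f0.
have fE : f =1 f0 by move=> v; rewrite lfunE.
have fbE : map f b = b' by rewrite -fb; apply: eq_map.
have fU : (f @: U = U')%VS.
  by rewrite -(span_basis bU) limg_span fbE (span_basis bU').
exists f; split=> //.
  move=> v w vU wU /eqP; rewrite -subr_eq0 -linearB -memv_ker => vwK.
  apply/eqP; rewrite -subr_eq0 -memv0; suff <- : (U :&: lker f = 0)%VS.
    by rewrite memv_cap vwK rpredB.
  apply/eqP; rewrite -dimv_eq0 -(eqn_add2r (\dim U')) -{1}fU limg_ker_dim.
  by rewrite dU.
rewrite -[V](span_basis (vbasisP V)) limg_span.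
have -> : map f (vbasis V) = vbasis V'.
  move: fbE; rewrite /b /b' map_cat => /eqP; rewrite eqseq_cat; last first.
    by rewrite size_map !size_tuple.
  by case/andP => /eqP.
exact: span_basis (vbasisP V').
Qed.
End Flags.

Theorem theorem3p4 (F : fieldType) (sigma : {rmorphism F -> F}) (eps : F)
  (Lam : zmodClosed F)
  (sigmaK : involutive sigma)
  (eps_unitary : eps * sigma eps = 1)
  (Lam_min : Lambda_min sigma eps `<=` [set` Lam])
  (Lam_max : [set` Lam] `<=` Lambda_max sigma eps)
  (E : vectType F) (q : Form sigma eps Lam E) :
  (forall (U W : {vspace E}) (f : {linear subvs_of U -> subvs_of W}),
     bijective f ->
     is_isometry (restrict_form q U) (restrict_form q W) f ->
     [set vsval (f u) | u in [set u | kernel q (vsval u)]]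
       = [set` W] `&` kernel q ->
     exists2 g : 'End(E), isometry_group q g &
       forall u : subvs_of U, g (vsval u) = vsval (f u))
  /\
  (forall d r : nat, acts_transitively (isometry_group q) (isotropics q d r)).
Proof.
have witt :=
  @witt_extension_group _ _ _ _ sigmaK eps_unitary Lam_min Lam_max _ q.
split=> [U W f fbij /isometryP[fom fQ] fK|d r].
  pose f' : 'End(E) :=
    (linfun (vsval : subvs_of W -> E) \o linfun f \o linfun (vsproj U))%VF.
  have f'E u : f' (vsval u) = vsval (f u).
    by rewrite !comp_lfunE !lfunE /= vsvalK.
  have inU v : v \in U -> exists u : subvs_of U, v = vsval u.
    by move=> vU; exists (vsproj U v); rewrite vsprojK.
  have [||||g gG gE] := witt U f'; last first.
  - by exists g => // u; rewrite gE ?subvsP.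
  - move=> _ /inU[u ->]; rewrite f'E; split=> [fuK|uK].
      have : ([set` W] `&` kernel q) (vsval (f u)) by split=> //; apply: subvsP.
      by rewrite -fK => -[v vK /val_inj/(bij_inj fbij) <-].
    suff [] : ([set` W] `&` kernel q) (vsval (f u)) by [].
    by rewrite -fK; exists u.
  - move=> _ _ /inU[u ->] /inU[v ->]; rewrite !f'E.
    by move/val_inj/(bij_inj fbij) ->.
  - move=> _ /inU[u ->]; have := fQ u.
    by rewrite f'E /restrict_form !Qform_pull.
  - move=> _ _ /inU[u ->] /inU[v ->]; have := fom u v.
    by rewrite !f'E /restrict_form !omega_pull.
split=> [g U gG|U W]; first exact: isometry_group_isotropics.
move=> [Uiso dimU [V VE dimV]] [Wiso dimW [V' VE' dimV']].
have VP (X Y : {vspace E}) v :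
    isotropic q X -> [set` X] `&` radical q = [set` Y] ->
    v \in Y <-> v \in X /\ kernel q v.
  move=> Xiso XY; rewrite -[is_true (v \in Y)]/([set` Y] v) -XY.
  split=> -[vX]; first by move/(isotropic_radical Xiso vX).
  by split=> //; apply/(isotropic_radical Xiso vX).
have sub (X Y : {vspace E}) :
    isotropic q X -> [set` X] `&` radical q = [set` Y] -> (Y <= X)%VS.
  by move=> Xiso XY; apply/subvP => v /(VP _ _ _ Xiso XY)[].
have [||f [finj fU fV]] := flag_transport (sub _ _ Uiso VE) (sub _ _ Wiso VE').
- by rewrite dimU dimW.
- by rewrite dimV dimV'.
have fW u : u \in U -> f u \in W by move=> uU; rewrite -fU memv_img.
have [Uom UQ] := (isotropicP q U).1 Uiso.
have [Wom WQ] := (isotropicP q W).1 Wiso.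
have [v w vU wU|v vU|//|u uU|g gG gE] := witt U f.
- by rewrite (Uom v w) // Wom // fW.
- by rewrite (UQ v) // WQ // fW.
- split=> uK.
    have /memv_imgP[v vV fuv] : f u \in (f @: V)%VS.
      by rewrite fV; apply/(VP _ _ _ Wiso VE'); split; rewrite ?fW.
    have [vU vK] := (VP _ _ _ Uiso VE).1 vV.
    by rewrite (finj u v).
  have uV : u \in V by apply/(VP _ _ _ Uiso VE).
  by have /(VP _ _ _ Wiso VE')[] : f u \in V' by rewrite -fV memv_img.
by exists g; rewrite // -fU; apply: eq_in_limg.
Qed.
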